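(* Consider on $\mathbb{R}^4=\mathbb{R}^2_{x_1,y_1}\times\mathbb{R}^2_{x_2,y_2}$ the five vector fields \[ \begin{aligned} \mathsf{D}^{(2)}&=-x_1\,\partial_{x_1}-y_1\,\partial_{y_1}-3x_2\,\partial_{x_2}-3y_2\,\partial_{y_2},\\ \mathsf{R}^{(2)}&=-y_1\,\partial_{x_1}+x_1\,\partial_{y_1}-y_2\,\partial_{x_2}+x_2\,\partial_{y_2},\\ \mathsf{I}_1^{(2)}&=\partial_{x_1}-4x_1y_1\,\partial_{x_2}+(6x_1^2+2y_1^2)\,\partial_{y_2},\\ \mathsf{I}_2^{(2)}&=\partial_{y_1}-(2x_1^2+6y_1^2)\,\partial_{x_2}+4x_1y_1\,\partial_{y_2},\\ \mathsf{J}^{(2)}&=0. \end{aligned} \] There exists a unique invariant $2$-dimensional submanifold $\Sigma_0^2\subset\mathbb{R}^4$; it is algebraic, graphed as \[ x_2=-2\,x_1^2y_1-2\,y_1^3,\qquad y_2=2\,x_1y_1^2+2\,x_1^3. \] Moreover, the complement $\mathbb{R}^4\setminus\Sigma_0^2$ is a single orbit under $\mathsf{D}^{(2)},\mathsf{R}^{(2)},\mathsf{I}_1^{(2)},\mathsf{I}_2^{(2)},\mathsf{J}^{(2)}$.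
   Context: The five vector fields are the restrictions, to the fiber over the origin $(u,x,y)=(0,0,0)$ of the space of $2$-jets $(u,x,y,x_1,y_1,x_2,y_2)$ of curves $u\mapsto(x(u),y(u))$ (with $x_1,y_1,x_2,y_2$ corresponding to $\dot x,\dot y,\ddot x,\ddot y$), of the second Lie prolongations of the five generators of the isotropy algebra at the origin of the Heisenberg sphere $v=z\overline{z}$ in $\mathbb{C}^2$, where $z=x+iy$, $w=u+iv$, written in the intrinsic coordinates $(x,y,u)$. An orbit is an orbit of the pseudogroup generated by the (local) flows of the five vector fields; a submanifold is invariant if it is (nonempty and) stable under all these flows. *)

(* Defs.v *)
From HB Require Import structures.
From mathcomp Require Import all_boot all_order all_algebra.
From mathcomp Require Import all_classical all_reals all_analysis.
(* The notations of mpoly clash with those of all_analysis. *)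
From mathcomp Require mpoly.
Import -(notations) mpoly.

Set Implicit Arguments.
Unset Strict Implicit.
Unset Printing Implicit Defensive.

Import Order.TTheory GRing.Theory Num.Theory.
Import numFieldNormedType.Exports.

Local Open Scope classical_set_scope.
Local Open Scope ring_scope.

(* All iterated partial derivatives of order at most k exist and are
   continuous at the points of U (meant for U open). *)
Fixpoint Ck_on (R : realType) (n k : nat) (U : set 'rV[R]_n)
    (f : 'rV[R]_n -> R) : Prop :=
  (forall x, U x -> {for x, continuous f}) /\
  match k with
  | 0 => True
  | k'.+1 => forall i : 'I_n,
      (forall x, U x -> derivable f x (delta_mx 0 i)) /\
      Ck_on k' U ('D_(delta_mx 0 i) f)
  end.

Definition smooth_on (R : realType) (n m : nat) (U : set 'rV[R]_n)
    (f : 'rV[R]_n -> 'rV[R]_m) : Prop :=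
  forall (k : nat) (j : 'I_m), Ck_on k U (fun x => f x 0 j).

(* phi and psi are total functions; only their values on U and V matter. *)
Definition diffeo_between (R : realType) (n : nat) (U V : set 'rV[R]_n)
    (phi psi : 'rV[R]_n -> 'rV[R]_n) : Prop :=
  [/\ open U /\ open V,
      smooth_on U phi /\ smooth_on V psi,
      forall x, U x -> V (phi x) /\ psi (phi x) = x &
      forall y, V y -> U (psi y) /\ phi (psi y) = y].

(* Around each of its points, S is straightened onto R^k x {0} by a smooth
   diffeomorphism between open subsets of R^n. S need not be closed. *)
Definition submanifold (R : realType) (n k : nat) (S : set 'rV[R]_n) : Prop :=
  (k <= n)%N /\
  forall p, S p -> exists (U V : set 'rV[R]_n) (phi psi : 'rV[R]_n -> 'rV[R]_n),
    [/\ U p, diffeo_between U V phi psi &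
        forall x, U x -> (S x <-> forall i : 'I_n, (k <= i)%N -> phi x 0 i = 0)].

Definition algebraic_set (R : realType) (n : nat) (S : set 'rV[R]_n) : Prop :=
  exists Ps : seq (mpoly.mpoly n R),
    S = [set p | forall P, P \in Ps -> mpoly.meval (fun i => p 0 i) P = 0].

(* q is the image of p under the time-t local flow of X: some integral curve
   of X, defined on an open interval containing 0 and t, leads from p to q. *)
Definition local_flow (R : realType) (n : nat) (X : 'rV[R]_n -> 'rV[R]_n)
    (t : R) (p q : 'rV[R]_n) : Prop :=
  exists (a b : R) (c : R -> 'rV[R]_n),
    [/\ a < 0 < b, a < t < b, c 0 = p, c t = q &
        forall s : R, a < s < b -> is_derive s 1 c (X (c s))].

Definition flow_invariant (R : realType) (n : nat)
    (F : set ('rV[R]_n -> 'rV[R]_n)) (S : set 'rV[R]_n) : Prop :=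
  forall X t p q, F X -> local_flow X t p q -> S p -> S q.

(* Finite compositions of local flows. Times of both signs are allowed, so
   reachability is symmetric. *)
Inductive reachable (R : realType) (n : nat)
    (F : set ('rV[R]_n -> 'rV[R]_n)) (p : 'rV[R]_n) : 'rV[R]_n -> Prop :=
  | reachable_refl : reachable F p p
  | reachable_step X t q r :
      F X -> reachable F p q -> local_flow X t q r -> reachable F p r.

Definition is_orbit (R : realType) (n : nat)
    (F : set ('rV[R]_n -> 'rV[R]_n)) (S : set 'rV[R]_n) : Prop :=
  exists p, S = [set q | reachable F p q].

(* The coordinates of R^4 are ordered as (x1, y1, x2, y2). *)
Definition i_x1 : 'I_4 := @Ordinal 4 0 isT.
Definition i_y1 : 'I_4 := @Ordinal 4 1 isT.
Definition i_x2 : 'I_4 := @Ordinal 4 2 isT.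
Definition i_y2 : 'I_4 := @Ordinal 4 3 isT.

Definition x1 (R : realType) (p : 'rV[R]_4) : R := p 0 i_x1.
Definition y1 (R : realType) (p : 'rV[R]_4) : R := p 0 i_y1.
Definition x2 (R : realType) (p : 'rV[R]_4) : R := p 0 i_x2.
Definition y2 (R : realType) (p : 'rV[R]_4) : R := p 0 i_y2.

Definition d_x1 (R : realType) : 'rV[R]_4 := delta_mx 0 i_x1.
Definition d_y1 (R : realType) : 'rV[R]_4 := delta_mx 0 i_y1.
Definition d_x2 (R : realType) : 'rV[R]_4 := delta_mx 0 i_x2.
Definition d_y2 (R : realType) : 'rV[R]_4 := delta_mx 0 i_y2.

Definition vf_D (R : realType) (p : 'rV[R]_4) : 'rV[R]_4 :=
  - x1 p *: d_x1 R - y1 p *: d_y1 R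
  - (3 * x2 p) *: d_x2 R - (3 * y2 p) *: d_y2 R.

Definition vf_R (R : realType) (p : 'rV[R]_4) : 'rV[R]_4 :=
  - y1 p *: d_x1 R + x1 p *: d_y1 R - y2 p *: d_x2 R + x2 p *: d_y2 R.

Definition vf_I1 (R : realType) (p : 'rV[R]_4) : 'rV[R]_4 :=
  d_x1 R - (4 * x1 p * y1 p) *: d_x2 R
  + (6 * x1 p ^+ 2 + 2 * y1 p ^+ 2) *: d_y2 R.

Definition vf_I2 (R : realType) (p : 'rV[R]_4) : 'rV[R]_4 :=
  d_y1 R - (2 * x1 p ^+ 2 + 6 * y1 p ^+ 2) *: d_x2 R
  + (4 * x1 p * y1 p) *: d_y2 R.

Definition vf_J (R : realType) (p : 'rV[R]_4) : 'rV[R]_4 := 0.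

Definition five_fields (R : realType) : set ('rV[R]_4 -> 'rV[R]_4) :=
  [set @vf_D R; @vf_R R; @vf_I1 R; @vf_I2 R; @vf_J R].
Arguments five_fields R : clear implicits.

(* Main.v *)
Require Import Defs.
From mathcomp Require Import all_boot all_order all_algebra.
From mathcomp Require Import all_classical all_reals all_analysis.
From mathcomp Require mpoly.
From mathcomp Require Import ring lra.
Import -(notations) mpoly.
Import Order.TTheory GRing.Theory Num.Theory.
Import numFieldNormedType.Exports.
Local Open Scope classical_set_scope.
Local Open Scope ring_scope.

(** Everything becomes transparent in the coordinates (x1, y1, u, v), where
    u = x2 + 2 x1^2 y1 + 2 y1^3 and v = y2 - 2 x1 y1^2 - 2 x1^3 measure how far
    a point is from the graph. There I1 and I2 are the two translations of the
    (x1, y1)-plane, R is the simultaneous rotation of the (x1, y1)- and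
    (u, v)-planes, and D contracts (x1, y1) with weight 1 and (u, v) with
    weight 3. Hence R^4 is R^2 x R^2 with transitive translations on the first
    factor and rotations and dilations on the second one, so that there are
    exactly two orbits, u = v = 0 and its complement.

    - Invariance of the two pieces: along an integral curve of any of the five
      fields, u^2 + v^2 satisfies a linear equation g' = k g, so it vanishes at
      all times or at none (field_sqdefect, linear_ode_zero).
    - Transitivity on each piece: explicit integral curves (reach_I1, reach_I2,
      reach_D, reach_R). One moves to x1 = y1 = 0, rotates and dilates
      there by polar coordinates, and moves back (reach_off_surface).
    - The surface is a submanifold because (x1, y1, x2, y2) -> (x1, y1, u, v)
      is a polynomial automorphism of R^4 with polynomial inverse.
    - Uniqueness: an invariant set is a union of orbits. If it meets the
      complement, it contains this nonempty open set, which no 2-dimensional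
      submanifold does (submanifold_open_subset); otherwise it is a nonempty
      part of a single orbit, the surface. *)

(** * Smoothness of polynomial functions *)

Section Poly.
Context {R : realType} {n : nat}.

(** An inductive predicate rather than evaluation of a formal polynomial, so that
    stability under directional derivatives is a plain induction. *)
Inductive polyfun : ('rV[R]_n -> R) -> Prop :=
  | polyfun_cst c : polyfun (fun=> c)
  | polyfun_coord i : polyfun (fun p => p 0 i)
  | polyfunD f g : polyfun f -> polyfun g -> polyfun (fun p => f p + g p)
  | polyfunM f g : polyfun f -> polyfun g -> polyfun (fun p => f p * g p).

Lemma polyfunN f : polyfun f -> polyfun (fun p => - f p).
Proof.
move=> pf; rewrite (_ : (fun _ => _) = (fun p => -1 * f p)); last first.
  by apply/funext => p; rewrite mulN1r.
exact: polyfunM (polyfun_cst _) pf.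
Qed.

Lemma polyfunX f k : polyfun f -> polyfun (fun p => f p ^+ k).
Proof.
move=> pf; elim: k => [|k IH]; first exact: polyfun_cst.
rewrite (_ : (fun _ => _) = (fun p => f p * f p ^+ k)); first exact: polyfunM.
by apply/funext => p; rewrite exprS.
Qed.

Lemma polyfun_differentiable f p : polyfun f -> differentiable f p.
Proof.
elim=> [c|i|g h _ dg _ dh|g h _ dg _ dh].
- exact: differentiable_cst.
- exact: differentiable_coord.
- exact: differentiableD.
- exact: differentiableM.
Qed.

Lemma polyfun_continuous f : polyfun f -> continuous f.
Proof. by move=> pf p; apply/differentiable_continuous/polyfun_differentiable. Qed.

(** This stability is what makes all iterated partial derivatives exist. *)
Lemma polyfun_derive f v : polyfun f -> polyfun ('D_v f).
Proof.
have der g p : polyfun g -> derivable g p v.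
  by move=> pg; apply/diff_derivable/polyfun_differentiable.
elim=> [c|i|g h pg dg ph dh|g h pg dg ph dh].
- rewrite (_ : 'D_v _ = fun=> 0); first exact: polyfun_cst.
  by apply/funext => p; rewrite derive_cst.
- rewrite (_ : 'D_v _ = fun=> v 0 i); first exact: polyfun_cst.
  apply/funext => p.
  have /derive_mx := @derivable_id R 'rV[R]_n p v.
  by rewrite derive_id => /rowP /(_ i); rewrite mxE => <-.
- rewrite (_ : 'D_v _ = fun p => 'D_v g p + 'D_v h p); first exact: polyfunD.
  by apply/funext => p; rewrite deriveD//; apply: der.
- rewrite (_ : 'D_v _ = fun p => g p * 'D_v h p + h p * 'D_v g p).
    by apply: polyfunD; apply: polyfunM.
  by apply/funext => p; rewrite deriveM//; apply: der.
Qed.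

Lemma polyfun_Ck k f : polyfun f -> Ck_on k setT f.
Proof.
elim: k f => [|k IH] f pf; split => //.
- by move=> p _; exact: polyfun_continuous.
- by move=> p _; exact: polyfun_continuous.
- move=> i; split; first by move=> p _; apply/diff_derivable/polyfun_differentiable.
  exact/IH/polyfun_derive.
Qed.

End Poly.

Section RealTools.
Context {R : realType}.

(** * Submanifolds of positive codimension have empty interior *)

Lemma continuous_rV {T : topologicalType} {n} (f : T -> 'rV[R]_n) (t : T) :
  (forall j, {for t, continuous (fun x => f x 0 j)}) -> {for t, continuous f}.
Proof.
move=> fc A [P nP PA].
have : \forall x \near t, forall j : 'I_n, P 0 j (f x 0 j).
  by apply: filter_forall => j; apply: fc; apply: nP.
by apply: filterS => x Px; apply: PA => i j; rewrite (ord1 i).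
Qed.

(** A chart sends the points of O in its domain into R^k x {0}. Moving slightly
    from a point of their image along the coordinate axis of index k stays in
    that image, by continuity of the inverse chart, but leaves R^k x {0}. *)
Lemma submanifold_open_subset n k (S O : set 'rV[R]_n) :
  (k < n)%N -> submanifold k S -> open O -> O `<=` S -> O = set0.
Proof.
move=> kn [_ chart] oO OS; rewrite -subset0 => p Op.
have [U [V [phi [psi [Up [[oU oV] [_ spsi] phiV psiU] straight]]]]] :=
  chart p (OS p Op).
have [Vy psiy] := phiV p Up; set y := phi p in Vy psiy.
pose i := Ordinal kn.
have yi : y 0 i = 0 by apply: (straight p Up).1 => //; apply: OS.
pose line (s : R) : 'rV[R]_n := y + s *: delta_mx 0 i.
have line0 : line 0 = y by rewrite /line scale0r addr0.
have linec : line @ 0 --> y.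
  rewrite -[in X in _ --> X]line0; apply: cvgD; first exact: cvg_cst.
  exact: scalel_continuous.
have psic : psi @ y --> p.
  rewrite -[in X in _ --> X]psiy; apply: continuous_rV => j.
  by have [/(_ y Vy)] := spsi 0 j.
have nV : \forall s \near 0, V (line s).
  by apply: linec; apply: open_nbhs_nbhs.
have nO : \forall s \near 0, O (psi (line s)).
  by apply: (cvg_comp _ _ linec psic); apply: open_nbhs_nbhs.
have [s [[Vs Os] s0]] : exists s, (V (line s) /\ O (psi (line s))) /\ s != 0.
  apply: (@filter_ex _ (0^')); near=> s; split.
    by split; near: s; apply: nbhs_dnbhs.
  by near: s; exact: nbhs_dnbhs_neq.
have [Upsi phipsi] := psiU _ Vs.
have := (straight _ Upsi).1 (OS _ Os) i (leqnn _).
rewrite phipsi !mxE yi !eqxx mulr1 add0r => s00.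
by rewrite s00 eqxx in s0.
Unshelve. all: by end_near. Qed.

(** * Derivatives, linear equations and polar coordinates *)

Lemma is_derive_rowP {n} (c : R -> 'rV[R]_n) (t : R) (v : 'rV[R]_n) :
  is_derive t 1 c v <-> forall j, is_derive t 1 (fun s => c s 0 j) (v 0 j).
Proof.
split=> [[dc <-] j|dc].
  have dcj := (derivable_mxP c t 1).1 dc 0 j.
  by apply: DeriveDef => //; rewrite derive_mx// mxE.
have der : derivable c t 1.
  by apply/derivable_mxP => i j; rewrite (ord1 i); have [] := dc j.
apply: DeriveDef => //; apply/rowP => j; rewrite derive_mx// mxE.
by have [] := dc j.
Qed.

(** The product of g with the integrating factor exp(-k r) has zero derivative,
    hence is constant on the interval. *)
Lemma linear_ode_zero (g : R -> R) (k a b s t : R) :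
  (forall r, a < r < b -> is_derive r 1 g (k * g r)) ->
  a < s < b -> a < t < b -> g s = 0 -> g t = 0.
Proof.
move=> dg sab tab gs.
pose h := (expR \o ( *%R (- k))) * g.
have dh r : a < r < b -> is_derive r 1 h 0.
  move=> /dg dgr; apply: is_derive_eq.
  rewrite /= [_%:A]mulr1 /GRing.scale/=.
  ring.
suff : h s = h t.
  rewrite /h /= !fctE gs mulr0 => /esym/eqP.
  by rewrite mulf_eq0 expR_eq0 => /eqP.
have cst x y : a < x < b -> a < y < b -> x <= y -> h x = h y.
  move=> /andP[ax xb] /andP[ay yb] xy.
  have inab r : x <= r -> r <= y -> a < r < b.
    by move=> xr ry; rewrite (lt_le_trans ax xr) (le_lt_trans ry yb).
  have [||r _] := @MVT_segment R h (fun=> 0) _ _ xy.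
  - by move=> r; rewrite in_itv/= => /andP[/ltW xr /ltW ry]; apply/dh/inab.
  - apply: derivable_within_continuous => r.
    rewrite in_itv/= => /andP[xr ry].
    by have [] := dh r (inab r xr ry).
  - by rewrite mul0r => /eqP; rewrite subr_eq0 => /eqP.
by have [st|/ltW ts] := leP s t; [apply: cst|apply/esym/cst].
Qed.

Lemma polar (a b : R) : (a, b) != (0, 0) ->
  exists r t, [/\ 0 < r, a = r * cos t & b = r * sin t].
Proof.
move=> ab0.
pose r := Num.sqrt (a ^+ 2 + b ^+ 2).
have n0 : 0 < a ^+ 2 + b ^+ 2.
  rewrite lt_def addr_ge0 ?sqr_ge0// andbT paddr_eq0 ?sqr_ge0//.
  by rewrite !sqrf_eq0; apply: contra ab0 => /andP[/eqP-> /eqP->].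
have r0 : 0 < r by rewrite sqrtr_gt0.
have r2 : r ^+ 2 = a ^+ 2 + b ^+ 2 by rewrite sqr_sqrtr// ltW.
have ar : -1 <= a / r <= 1.
  rewrite -ler_norml normrM normfV (gtr0_norm r0) ler_pdivrMr// mul1r.
  by rewrite -sqrtr_sqr ler_wsqrtr// lerDl sqr_ge0.
have cosa : cos (acos (a / r)) = a / r by rewrite acosK// in_itv.
have sina : r * sin (acos (a / r)) = `|b|.
  rewrite sin_acos// -{1}(gtr0_norm r0) -sqrtr_sqr -sqrtrM ?sqr_ge0//.
  rewrite -(sqrtr_sqr b); congr (Num.sqrt _).
  rewrite mulrBr mulr1 -exprMn mulrC divfK ?gt_eqF//.
  by rewrite r2; ring.
have ra : r * (a / r) = a by rewrite mulrC divfK ?gt_eqF.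
(* The inverse cosine only sees the upper half circle; for b < 0 its opposite is
   the right angle. *)
exists r; have [b0|b0] := leP 0 b.
  by exists (acos (a / r)); split; rewrite ?cosa ?ra ?sina ?ger0_norm.
exists (- acos (a / r)); split; rewrite ?cosN ?sinN ?cosa ?ra//.
by rewrite mulrN sina ltr0_norm// opprK.
Qed.

Lemma is_derive_ext_eq (f g : R -> R) (t a b : R) : is_derive t 1 f a ->
  f =1 g -> a = b -> is_derive t 1 g b.
Proof. by move=> df /funext <- <-. Qed.

(** Meant for the integral curves of I1 and I2, whose coordinates are polynomials
    of degree at most 3 in time. *)
Lemma is_derive_cubic (k0 k1 k2 k3 t : R) :
  is_derive t 1 (fun r => k0 + k1 * r + k2 * r ^+ 2 + k3 * r ^+ 3)
    (k1 + 2 * k2 * t + 3 * k3 * t ^+ 2).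
Proof.
pose d1 := is_derive_id t (1 : R).
have := is_deriveD (is_deriveD (is_deriveD (is_derive_cst k0 t (1 : R))
  (is_deriveZ k1 d1)) (is_deriveZ k2 (is_deriveX 2 d1)))
  (is_deriveZ k3 (is_deriveX 3 d1)).
by move=> /is_derive_ext_eq; apply=> //; rewrite /GRing.scale /=; ring.
Qed.

End RealTools.

Section Flow.
Context {R : realType}.
Implicit Types (p q : 'rV[R]_4) (x y u v t : R).

(** * The fields in components *)

Definition row4 (a b c d : R) : 'rV[R]_4 := \row_(j < 4) [:: a; b; c; d]`_j.

Lemma row4_x1 a b c d : x1 (row4 a b c d) = a. Proof. by rewrite /x1 mxE. Qed.
Lemma row4_y1 a b c d : y1 (row4 a b c d) = b. Proof. by rewrite /y1 mxE. Qed.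
Lemma row4_x2 a b c d : x2 (row4 a b c d) = c. Proof. by rewrite /x2 mxE. Qed.
Lemma row4_y2 a b c d : y2 (row4 a b c d) = d. Proof. by rewrite /y2 mxE. Qed.
Definition row4E := (row4_x1, row4_y1, row4_x2, row4_y2).

Lemma forall_ord4 (P : 'I_4 -> Prop) :
  P i_x1 -> P i_y1 -> P i_x2 -> P i_y2 -> forall j, P j.
Proof.
move=> P0 P1 P2 P3 [[|[|[|[|//]]]] ?]; [move: P0|move: P1|move: P2|move: P3];
  by congr P; apply/val_inj.
Qed.

Lemma row4_eta p : p = row4 (x1 p) (y1 p) (x2 p) (y2 p).
Proof. by apply/rowP; apply: forall_ord4; rewrite mxE. Qed.

Lemma vf_DE p :
  vf_D p = row4 (- x1 p) (- y1 p) (- (3 * x2 p)) (- (3 * y2 p)).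
Proof.
by apply/rowP; apply: forall_ord4; rewrite !mxE/= /x1 /y1 /x2 /y2; ring.
Qed.

Lemma vf_RE p : vf_R p = row4 (- y1 p) (x1 p) (- y2 p) (x2 p).
Proof.
by apply/rowP; apply: forall_ord4; rewrite !mxE/= /x1 /y1 /x2 /y2; ring.
Qed.

Lemma vf_I1E p : vf_I1 p =
  row4 1 0 (- (4 * x1 p * y1 p)) (6 * x1 p ^+ 2 + 2 * y1 p ^+ 2).
Proof.
by apply/rowP; apply: forall_ord4; rewrite !mxE/= /x1 /y1 /x2 /y2; ring.
Qed.

Lemma vf_I2E p : vf_I2 p =
  row4 0 1 (- (2 * x1 p ^+ 2 + 6 * y1 p ^+ 2)) (4 * x1 p * y1 p).
Proof.
by apply/rowP; apply: forall_ord4; rewrite !mxE/= /x1 /y1 /x2 /y2; ring.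
Qed.

Lemma vf_JE p : vf_J p = row4 0 0 0 0.
Proof. by apply/rowP; apply: forall_ord4; rewrite !mxE. Qed.

Lemma is_derive_row4 (a b c d : R -> R) t a' b' c' d' :
  is_derive t 1 a a' -> is_derive t 1 b b' ->
  is_derive t 1 c c' -> is_derive t 1 d d' ->
  is_derive t 1 (fun s => row4 (a s) (b s) (c s) (d s)) (row4 a' b' c' d').
Proof.
move=> da db dc dd; apply/is_derive_rowP; apply: forall_ord4;
  by under eq_fun do rewrite mxE/=; rewrite mxE.
Qed.

Lemma is_derive_row4P (c : R -> 'rV[R]_4) t a' b' c' d' :
  is_derive t 1 c (row4 a' b' c' d') <->
  [/\ is_derive t 1 (@x1 R \o c) a', is_derive t 1 (@y1 R \o c) b',
      is_derive t 1 (@x2 R \o c) c' & is_derive t 1 (@y2 R \o c) d'].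
Proof.
rewrite is_derive_rowP; split=> [dc|[da db dc dd]].
  have := (dc i_x1, dc i_y1, dc i_x2, dc i_y2).
  by rewrite !mxE/= => -[[[]]].
by apply: forall_ord4; rewrite mxE.
Qed.

(** * Defect coordinates and the invariant surface *)

(** The coordinates u and v, whose common zero locus is the surface. *)
Definition defect_x p : R := x2 p + 2 * x1 p ^+ 2 * y1 p + 2 * y1 p ^+ 3.
Definition defect_y p : R := y2 p - 2 * x1 p * y1 p ^+ 2 - 2 * x1 p ^+ 3.

(** A single function cuts out the surface: this spares a linear system for the
    pair (u, v), which R rotates. *)
Definition sqdefect p : R := defect_x p ^+ 2 + defect_y p ^+ 2.

Definition surface : set 'rV[R]_4 :=
  [set p | x2 p = - 2 * x1 p ^+ 2 * y1 p - 2 * y1 p ^+ 3 /\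
           y2 p = 2 * x1 p * y1 p ^+ 2 + 2 * x1 p ^+ 3].

Lemma surface_defect p : surface p <-> defect_x p = 0 /\ defect_y p = 0.
Proof.
rewrite /surface /defect_x /defect_y/=; split=> -[ex ey]; split.
- by rewrite ex; ring.
- by rewrite ey; ring.
- by apply/eqP; rewrite -subr_eq0 -[X in _ == X]ex; apply/eqP; ring.
- by apply/eqP; rewrite -subr_eq0 -[X in _ == X]ey; apply/eqP; ring.
Qed.

Lemma surface_sqdefect p : surface p <-> sqdefect p = 0.
Proof.
rewrite surface_defect /sqdefect; split=> [[-> ->]|/eqP]; first by ring.
rewrite paddr_eq0 ?sqr_ge0// !sqrf_eq0.
by move=> /andP[/eqP-> /eqP->].
Qed.

Lemma surface_nonempty : surface !=set0.
Proof.
exists (row4 0 0 0 0); apply/surface_defect.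
by rewrite /defect_x /defect_y !row4E; split; ring.
Qed.

Lemma defect_along c t a' b' c' d' :
  is_derive t 1 c (row4 a' b' c' d') ->
  is_derive t 1 (defect_x \o c)
   (c' + 4 * x1 (c t) * y1 (c t) * a'
    + (2 * x1 (c t) ^+ 2 + 6 * y1 (c t) ^+ 2) * b') /\
  is_derive t 1 (defect_y \o c)
   (d' - 4 * x1 (c t) * y1 (c t) * b'
    - (6 * x1 (c t) ^+ 2 + 2 * y1 (c t) ^+ 2) * a').
Proof.
move=> /is_derive_row4P[].
set cx := @x1 R \o c; set cy := @y1 R \o c.
set cx2 := @x2 R \o c; set cy2 := @y2 R \o c.
move=> dx dy dx2 dy2.
have dxx := is_deriveX 2 dx. have dxxx := is_deriveX 3 dx.
have dyy := is_deriveX 2 dy. have dyyy := is_deriveX 3 dy.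
split.
- have := is_deriveD (is_deriveD dx2 (is_deriveZ 2 (is_deriveM dxx dy)))
    (is_deriveZ 2 dyyy).
  move=> /is_derive_ext_eq; apply.
    by move=> s; rewrite /= /defect_x -!mulrA.
  by rewrite /GRing.scale /= !fctE /cx /cy /=;
    move: (x1 (c t)) (y1 (c t)) => X Y; ring.
- have := is_deriveB (is_deriveB dy2 (is_deriveZ 2 (is_deriveM dx dyy)))
    (is_deriveZ 2 dxxx).
  move=> /is_derive_ext_eq; apply.
    by move=> s; rewrite /= /defect_y -!mulrA.
  by rewrite /GRing.scale /= !fctE /cx /cy /=;
    move: (x1 (c t)) (y1 (c t)) => X Y; ring.
Qed.

Lemma sqdefect_along c t a' b' c' d' :
  is_derive t 1 c (row4 a' b' c' d') ->
  is_derive t 1 (sqdefect \o c)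
   (2 * defect_x (c t) * (c' + 4 * x1 (c t) * y1 (c t) * a'
         + (2 * x1 (c t) ^+ 2 + 6 * y1 (c t) ^+ 2) * b')
  + 2 * defect_y (c t) * (d' - 4 * x1 (c t) * y1 (c t) * b'
         - (6 * x1 (c t) ^+ 2 + 2 * y1 (c t) ^+ 2) * a')).
Proof.
move=> /defect_along[/(is_deriveX 2) dx /(is_deriveX 2) dy].
have := is_deriveD dx dy.
by move=> /is_derive_ext_eq; apply=> //; rewrite /GRing.scale /= !expr1.
Qed.

(** D has weight -3 on (u, v), whence k = -6; the translations I1 and I2 fix
    (u, v), the rotation R preserves its norm, and J is zero, whence k = 0. *)
Lemma field_sqdefect (X : 'rV[R]_4 -> 'rV[R]_4) : five_fields R X ->
  exists k : R, forall c t, is_derive t 1 c (X (c t)) ->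
    is_derive t 1 (sqdefect \o c) (k * sqdefect (c t)).
Proof.
move=> [[[[]|]|]|] ->; [exists (-6)|exists 0..];
  move=> c t; rewrite ?(vf_DE, vf_RE, vf_I1E, vf_I2E, vf_JE);
  move=> /sqdefect_along h; apply: is_derive_eq;
  rewrite /sqdefect /defect_x /defect_y; ring.
Qed.

(** An equivalence, so that both the surface and its complement are invariant. *)
Lemma local_flow_surface (X : 'rV[R]_4 -> 'rV[R]_4) t p q :
  five_fields R X -> local_flow X t p q -> surface p <-> surface q.
Proof.
move=> /field_sqdefect[k dX] [a [b [c [ab tab <- <- dc]]]].
have ode s : a < s < b ->
    is_derive s 1 (sqdefect \o c) (k * (sqdefect \o c) s).
  by move=> /dc; exact: dX.
rewrite !surface_sqdefect; split; exact: linear_ode_zero ode _ _.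
Qed.

Lemma flow_invariant_surface : flow_invariant (five_fields R) surface.
Proof. by move=> X t p q FX /(local_flow_surface _ _ _ _ FX) <-. Qed.

Lemma reachable_surface p q :
  reachable (five_fields R) p q -> surface p <-> surface q.
Proof.
by elim=> // X t r s FX _ IH /(local_flow_surface _ _ _ _ FX) <-.
Qed.

(** * Explicit flows *)

Lemma reachable_trans (F : set ('rV[R]_4 -> 'rV[R]_4)) p q r :
  reachable F p q -> reachable F q r -> reachable F p r.
Proof.
move=> pq; elim=> // X t s s' FX _ ps; exact: reachable_step FX ps.
Qed.

Lemma reachable_curve (F : set ('rV[R]_4 -> 'rV[R]_4)) X (c : R -> 'rV[R]_4) t :
  F X -> (forall r : R, is_derive r 1 c (X (c r))) -> reachable F (c 0) (c t).
Proof.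
move=> FX dc; apply: (@reachable_step _ _ _ _ X t) => //.
  exact: reachable_refl.
(* Any open interval containing 0 and t will do, as c is integral on all of R. *)
exists (- (`|t| + 1)), (`|t| + 1), c.
have t0 := normr_ge0 t.
split => //; first by apply/andP; split; lra.
have := lexx `|t|; rewrite ler_norml => /andP[? ?].
by apply/andP; split; lra.
Qed.

(** The inverse of the passage to the coordinates (x1, y1, u, v), called adapted
    below because I1 and I2 become translations in them. *)
Definition adapted x y u v : 'rV[R]_4 :=
  row4 x y (u - 2 * x ^+ 2 * y - 2 * y ^+ 3) (v + 2 * x * y ^+ 2 + 2 * x ^+ 3).

Lemma adapted_eta p :
  p = adapted (x1 p) (y1 p) (defect_x p) (defect_y p).
Proof.
rewrite [LHS]row4_eta /adapted /defect_x /defect_y; congr row4; ring.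
Qed.

Local Notation reach := (reachable (five_fields R)).

(** In adapted coordinates I1 is the unit translation in x; the cubics list the
    Taylor coefficients in r of the components of adapted (x + r) y u v. *)
Lemma reach_I1 x x' y u v : reach (adapted x y u v) (adapted x' y u v).
Proof.
pose c r := adapted (x + r) y u v.
have -> : adapted x y u v = c 0 by rewrite /c addr0.
have -> : adapted x' y u v = c (x' - x) by rewrite /c addrC subrK.
apply: (@reachable_curve _ (@vf_I1 R)); first by do 2!left; right.
move=> r; rewrite vf_I1E !row4E; apply: is_derive_row4.
- by apply: is_derive_ext_eq (is_derive_cubic x 1 0 0 r) _ _ => [s|]; ring.
- by apply: is_derive_ext_eq (is_derive_cubic (u - 2 * x ^+ 2 * y - 2 * y ^+ 3)
      (- (4 * x * y)) (- (2 * y)) 0 r) _ _ => [s|]; ring.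
- by apply: is_derive_ext_eq (is_derive_cubic (v + 2 * x * y ^+ 2 + 2 * x ^+ 3)
      (2 * y ^+ 2 + 6 * x ^+ 2) (6 * x) 2 r) _ _ => [s|]; ring.
Qed.

Lemma reach_I2 x y y' u v : reach (adapted x y u v) (adapted x y' u v).
Proof.
pose c r := adapted x (y + r) u v.
have -> : adapted x y u v = c 0 by rewrite /c addr0.
have -> : adapted x y' u v = c (y' - y) by rewrite /c addrC subrK.
apply: (@reachable_curve _ (@vf_I2 R)); first by left; right.
move=> r; rewrite vf_I2E !row4E; apply: is_derive_row4.
- by apply: is_derive_ext_eq (is_derive_cubic y 1 0 0 r) _ _ => [s|]; ring.
- by apply: is_derive_ext_eq (is_derive_cubic (u - 2 * x ^+ 2 * y - 2 * y ^+ 3)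
      (- (2 * x ^+ 2 + 6 * y ^+ 2)) (- (6 * y)) (- 2) r) _ _ => [s|]; ring.
- by apply: is_derive_ext_eq (is_derive_cubic (v + 2 * x * y ^+ 2 + 2 * x ^+ 3)
      (4 * x * y) (2 * x) 0 r) _ _ => [s|]; ring.
Qed.

Lemma reach_fiber x y x' y' u v :
  reach (adapted x y u v) (adapted x' y' u v).
Proof. exact: reachable_trans (reach_I1 _ _ _ _ _) (reach_I2 _ _ _ _ _). Qed.

(** D and R also move (x1, y1), but both fix the origin of that plane, where the
    surface correction vanishes and u, v are x2, y2. *)
Lemma adapted00 u v : adapted 0 0 u v = row4 0 0 u v.
Proof. by rewrite /adapted; congr row4; ring. Qed.

Lemma reach_D u v r : 0 < r ->
  reach (adapted 0 0 u v) (adapted 0 0 (r * u) (r * v)).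
Proof.
move=> r0; rewrite !adapted00.
pose c s := row4 0 0 (expR (-3 * s) * u) (expR (-3 * s) * v).
have -> : row4 0 0 u v = c 0 by rewrite /c mulr0 expR0 !mul1r.
have -> : row4 0 0 (r * u) (r * v) = c (- (ln r / 3)).
  by rewrite /c (_ : -3 * _ = ln r) ?lnK//; field.
apply: (@reachable_curve _ (@vf_D R)); first by do 4!left.
have dexp (w s : R) : is_derive s 1 (fun s => expR (-3 * s) * w)
    (- (3 * (expR (-3 * s) * w))).
  have dlin := is_deriveZ (-3) (is_derive_id s (1 : R)).
  have := is_deriveZ w (is_derive1_comp (is_derive_expR (-3 * s)) dlin).
  move=> /is_derive_ext_eq; apply=> [s'|]; first by rewrite !fctE mulrC.
  by rewrite [_%:A]mulr1 /GRing.scale /=; ring.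
move=> s; rewrite vf_DE !row4E !oppr0.
have d0 := is_derive_cst (0 : R) s (1 : R).
exact: (is_derive_row4 _ _ _ _ _ _ _ _ _ d0 d0 (dexp u s) (dexp v s)).
Qed.

Lemma reach_R u v t : reach (adapted 0 0 u v)
  (adapted 0 0 (cos t * u - sin t * v) (sin t * u + cos t * v)).
Proof.
rewrite !adapted00.
pose c s := row4 0 0 (cos s * u - sin s * v) (sin s * u + cos s * v).
have -> : row4 0 0 u v = c 0.
  by rewrite /c cos0 sin0 !mul1r !mul0r subr0 add0r.
apply: (@reachable_curve _ (@vf_R R) c); first by do 3!left; right.
move=> s; rewrite vf_RE !row4E !oppr0.
have d0 := is_derive_cst (0 : R) s (1 : R).
apply: (is_derive_row4 _ _ _ _ _ _ _ _ _ d0 d0).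
- have := is_deriveB (is_deriveZ u (is_derive_cos s))
    (is_deriveZ v (is_derive_sin s)).
  move=> /is_derive_ext_eq; apply=> [s'|]; last by rewrite /GRing.scale/=; ring.
  by rewrite (mulrC (cos s')) (mulrC (sin s')).
- have := is_deriveD (is_deriveZ u (is_derive_sin s))
    (is_deriveZ v (is_derive_cos s)).
  move=> /is_derive_ext_eq; apply=> [s'|]; last by rewrite /GRing.scale/=; ring.
  by rewrite (mulrC (cos s')) (mulrC (sin s')).
Qed.

(** Two nonzero plane vectors differ by a rotation and a positive homothety. *)
Lemma reach_origin_fiber u v u' v' : (u, v) != (0, 0) -> (u', v') != (0, 0) ->
  reach (adapted 0 0 u v) (adapted 0 0 u' v').
Proof.
move=> /polar[r [t [r0 -> ->]]] /polar[r' [t' [r'0 -> ->]]].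
move: (t' - t) (subrK t t') => w <-.
apply: reachable_trans (reach_R _ _ w) _.
have r'r : 0 < r' / r by rewrite divr_gt0.
have := reach_D (r * cos (w + t)) (r * sin (w + t)) _ r'r.
congr (reach (adapted 0 0 _ _) (adapted 0 0 _ _)).
- by rewrite cosD; ring.
- by rewrite sinD; ring.
- by field; rewrite gt_eqF.
- by field; rewrite gt_eqF.
Qed.

Lemma off_surface p : (~ surface p) -> (defect_x p, defect_y p) != (0, 0).
Proof. by move=> Sp; apply/eqP => -[dx dy]; apply/Sp/surface_defect. Qed.

(** Slide to x1 = y1 = 0, act there by the similarity taking one pair (u, v) to the
    other, and slide to the target. *)
Lemma reach_off_surface p q : ~ surface p -> ~ surface q -> reach p q.
Proof.
move=> /off_surface p0 /off_surface q0.
rewrite [p]adapted_eta [q]adapted_eta.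
apply: reachable_trans (reach_fiber _ _ 0 0 _ _) _.
apply: reachable_trans (reach_origin_fiber _ _ _ _ p0 q0) _.
exact: reach_fiber.
Qed.

Lemma reach_on_surface p q : surface p -> surface q -> reach p q.
Proof.
move=> /surface_defect[px py] /surface_defect[qx qy].
by rewrite [p]adapted_eta [q]adapted_eta px py qx qy; exact: reach_fiber.
Qed.

Lemma flow_invariant_reach (S : set 'rV[R]_4) p q :
  flow_invariant (five_fields R) S -> S p -> reach p q -> S q.
Proof. by move=> inv Sp; elim=> // X t r s FX _ Sr rs; exact: inv FX rs Sr. Qed.

(** * The surface as a submanifold and as an algebraic set *)

Lemma polyfun_x1 : polyfun (@x1 R). Proof. exact: polyfun_coord. Qed.
Lemma polyfun_y1 : polyfun (@y1 R). Proof. exact: polyfun_coord. Qed.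
Lemma polyfun_x2 : polyfun (@x2 R). Proof. exact: polyfun_coord. Qed.
Lemma polyfun_y2 : polyfun (@y2 R). Proof. exact: polyfun_coord. Qed.

Lemma polyfun_defect_x : polyfun defect_x.
Proof.
rewrite /defect_x.
by do ?[apply: polyfunD|apply: polyfunM|apply: polyfunX|exact: polyfun_cst|
  exact: polyfun_coord].
Qed.

Lemma polyfun_defect_y : polyfun defect_y.
Proof.
rewrite /defect_y.
by do ?[apply: polyfunN|apply: polyfunD|apply: polyfunM|apply: polyfunX|
  exact: polyfun_cst|exact: polyfun_coord].
Qed.

Ltac polyfun := repeat first [exact: polyfun_cst | exact: polyfun_x1
  | exact: polyfun_y1 | exact: polyfun_x2 | exact: polyfun_y2
  | exact: polyfun_defect_x | exact: polyfun_defect_y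
  | apply: polyfunX | apply: polyfunN | apply: polyfunD | apply: polyfunM].

Lemma open_off_surface : open (~` surface).
Proof.
have -> : ~` surface = sqdefect @^-1` [set r | r != 0].
  apply/seteqP; split=> p /=.
    by move=> Sp; apply/eqP => /surface_sqdefect.
  by move=> /eqP d0 /surface_sqdefect.
apply: open_comp; last exact: open_neq.
move=> p _; apply: polyfun_continuous; rewrite /sqdefect.
by apply: polyfunD; apply: polyfunX;
  [exact: polyfun_defect_x|exact: polyfun_defect_y].
Qed.

Lemma smooth_row4 (a b c d : 'rV[R]_4 -> R) :
  polyfun a -> polyfun b -> polyfun c -> polyfun d ->
  smooth_on setT (fun p => row4 (a p) (b p) (c p) (d p)).
Proof.
move=> pa pb pc pd k; apply: forall_ord4; under eq_fun do rewrite mxE/=;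
  exact: polyfun_Ck.
Qed.

(** One global chart suffices: the passage to adapted coordinates, with adapted as
    inverse. *)
Lemma submanifold_surface : submanifold 2 surface.
Proof.
split=> // p _.
exists setT, setT, (fun q => row4 (x1 q) (y1 q) (defect_x q) (defect_y q)),
  (fun q => adapted (x1 q) (y1 q) (x2 q) (y2 q)); split => //.
  split=> //.
  - by split; exact: openT.
  - split; apply: smooth_row4; polyfun.
  - by move=> q _; split=> //; rewrite !row4E -adapted_eta.
  - move=> q _; split=> //; rewrite [RHS]row4_eta /adapted /defect_x /defect_y.
    by rewrite !row4E; congr row4; ring.
move=> q _; rewrite surface_defect; split=> [[dx dy]|d0].
  by apply: forall_ord4 => //; rewrite mxE.
have := (d0 i_x2 isT, d0 i_y2 isT).
by rewrite !mxE/= => -[].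
Qed.

Lemma algebraic_surface : algebraic_set surface.
Proof.
pose X i : mpoly 4 R := mpolyX R (mnm1 i).
exists [:: X i_x2 + 2 * X i_x1 ^+ 2 * X i_y1 + 2 * X i_y1 ^+ 3;
           X i_y2 - 2 * X i_x1 * X i_y1 ^+ 2 - 2 * X i_x1 ^+ 3].
have mX p i : meval (fun i => p 0 i) (X i) = p 0 i by exact: mevalXU.
apply/seteqP; split=> p /=; rewrite surface_defect.
  move=> [dx dy] P; rewrite !inE => /orP[]/eqP->.
    by rewrite !rmorphD !(rmorphXn, rmorphM, rmorph_nat)/= !mX.
  by rewrite !rmorphB !(rmorphXn, rmorphM, rmorph_nat)/= !mX.
move=> h; split.
  rewrite -(h _ (mem_head _ _)).
  by rewrite !rmorphD !(rmorphXn, rmorphM, rmorph_nat)/= !mX.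
rewrite -(h _ (mem_last _ _)).
by rewrite !rmorphB !(rmorphXn, rmorphM, rmorph_nat)/= !mX.
Qed.

(** * Uniqueness and the open orbit *)

Lemma invariant_surface_eq (S : set 'rV[R]_4) :
  submanifold 2 S -> S !=set0 -> flow_invariant (five_fields R) S ->
  surface = S.
Proof.
move=> mS [p Sp] inv.
have Ssub : S `<=` surface.
  move=> q Sq; apply: contrapT => nq.
  have sub : ~` surface `<=` S.
    by move=> q' nq'; apply: flow_invariant_reach inv Sq _;
      exact: reach_off_surface.
  have := submanifold_open_subset _ _ _ _ _ mS open_off_surface sub.
  by move=> /(_ isT) e; have : (~` surface) q by []; rewrite e.
apply/seteqP; split=> // q Sigq; apply: (flow_invariant_reach _ _ _ inv Sp).
exact: reach_on_surface (Ssub _ Sp) Sigq.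
Qed.

Lemma is_orbit_off_surface : is_orbit (five_fields R) (~` surface).
Proof.
have n1 : ~ surface (row4 0 0 1 0).
  by move=> /surface_sqdefect; rewrite /sqdefect /defect_x /defect_y !row4E; lra.
exists (row4 0 0 1 0); apply/seteqP; split=> q /=.
  exact: reach_off_surface.
by move=> /reachable_surface r Sq; apply/n1/r.
Qed.

End Flow.

Theorem mainTheorem3 (R : realType) :
  exists Sigma0 : set 'rV[R]_4,
    unique (fun S : set 'rV[R]_4 =>
      [/\ submanifold 2 S, S !=set0 & flow_invariant (five_fields R) S]) Sigma0
    /\ algebraic_set Sigma0
    /\ Sigma0 = [set p | x2 p = - 2 * x1 p ^+ 2 * y1 p - 2 * y1 p ^+ 3 /\
                         y2 p = 2 * x1 p * y1 p ^+ 2 + 2 * x1 p ^+ 3]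
    /\ is_orbit (five_fields R) (~` Sigma0).
Proof.
exists surface; split; [|split; [|split=> //]].
- split; last by move=> S [? ? ?]; exact: invariant_surface_eq.
  split; [exact: submanifold_surface|exact: surface_nonempty|].
  exact: flow_invariant_surface.
- exact: algebraic_surface.
- exact: is_orbit_off_surface.
Qed.
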